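(* Let $s\ge 1$ be an integer. If $G$ is a petunia, then $\mathrm{HG}_s(G) \le (3s^2+3s+3)^{3(s^2+s+1)^2}$.
   Context: All graphs are finite and simple. A petal graph is obtained from a (possibly empty) path $P$ by adding a vertex adjacent to every vertex of $P$; a petunia is a graph in which every block is a subgraph of a petal graph. For an integer $s\ge1$, $\mathrm{HG}_s(G)$ is the maximum $k$ such that, with color set $\{1,\dots,k\}$, there is a strategy (each vertex $v$ has a function mapping each coloring of its neighborhood $N(v)$ to a set of at most $s$ colors) such that for every coloring $\phi:V(G)\to\{1,\dots,k\}$ some vertex $v$ has $\phi(v)$ in the set its function assigns to $\phi|_{N(v)}$. *)

(* Defs.v *)
From mathcomp Require Import all_boot.

Set Implicit Arguments.
Unset Strict Implicit.
Unset Printing Implicit Defensive.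

Record sgraph := SGraph {
  vertex :> finType;
  edge : rel vertex;
  edge_sym : symmetric edge;
  edge_irrefl : irreflexive edge
}.

(* H is isomorphic to a (not necessarily induced) subgraph of K. *)
Definition subgraph_of (H K : sgraph) : Prop :=
  exists2 f : H -> K, injective f & forall x y, edge x y -> edge (f x) (f y).

Section Induced.
Variables (G : sgraph) (B : {set G}).
Let U : finType := {x : G | x \in B}.
Definition induced_edge : rel U := [rel x y | edge (val x) (val y)].
Lemma induced_sym : symmetric induced_edge.
Proof. by move=> x y; apply: edge_sym. Qed.
Lemma induced_irrefl : irreflexive induced_edge.
Proof. by move=> x; apply: edge_irrefl. Qed.
Definition induced : sgraph := SGraph induced_sym induced_irrefl.
End Induced.

(* The path has vertices Some 0, ..., Some n.-1 in this order; None is the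
   additional vertex.  For n = 0 the path is empty. *)
Section Petal.
Variable n : nat.
Definition petal_edge : rel (option 'I_n) := fun x y =>
  match x, y with
  | Some i, Some j => (i.+1 == j) || (j.+1 == i)
  | None, None => false
  | _, _ => true
  end.
Lemma petal_sym : symmetric petal_edge.
Proof. by move=> [i|] [j|] //=; rewrite orbC. Qed.
Lemma petal_irrefl : irreflexive petal_edge.
Proof. by move=> [i|] //=; rewrite orbb gtn_eqF. Qed.
Definition petal : sgraph := SGraph petal_sym petal_irrefl.
End Petal.

Definition connected (G : sgraph) : Prop :=
  0 < #|G| /\ forall x y : G, connect (@edge G) x y.

(* v separates two other vertices of its component. *)
Definition cut_vertex (G : sgraph) (v : G) : Prop :=
  exists x y : G, [/\ x != v, y != v, connect (@edge G) x y
    & ~~ connect [rel a b : G | [&& a != v, b != v & edge a b]] x y].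

Definition connected_no_cut (G : sgraph) : Prop :=
  connected G /\ forall v : G, ~ cut_vertex v.

(* A block is a maximal connected subgraph without a cut vertex.  Adding edges
   between existing vertices preserves connectedness and creates no cut vertex,
   so blocks are induced subgraphs and are represented by their vertex sets. *)
Definition block (G : sgraph) (B : {set G}) : Prop :=
  connected_no_cut (induced B) /\
  forall C : {set G}, B \subset C -> connected_no_cut (induced C) -> C = B.

Definition petunia (G : sgraph) : Prop :=
  forall B : {set G}, block B -> exists n : nat, subgraph_of (induced B) (petal n).

Definition nbhd (G : sgraph) (v : G) : finType := {u : G | edge v u}.

Definition restrict (G : sgraph) (k : nat) (phi : {ffun G -> 'I_k}) (v : G) :
    {ffun nbhd v -> 'I_k} :=
  [ffun u => phi (val u)].

Definition strategy (G : sgraph) (k : nat) : finType :=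
  {dffun forall v : G, {ffun {ffun nbhd v -> 'I_k} -> {set 'I_k}}}.

Definition winnable (s : nat) (G : sgraph) (k : nat) : bool :=
  [exists f : strategy G k,
    [forall v, forall c, #|f v c| <= s] &&
    [forall phi : {ffun G -> 'I_k}, exists v, phi v \in f v (restrict phi v)]].

(* The range of k loses nothing: winnable_leq below shows that every winnable k
   satisfies it, and HG_geq and HG_winnable that HG s G is the largest winnable
   k.  If G has no vertex then no k is winnable, and HG s G = 0. *)
Definition HG (s : nat) (G : sgraph) : nat :=
  \max_(k < (s * #|G|).+1 | winnable s G k) k.

Section HGMax.
Variables (s : nat) (G : sgraph).

Lemma winnable_leq k : winnable s G k -> k <= s * #|G|.
Proof.
case/existsP=> f /andP[/forallP fs /forallP fw].
case: k f fs fw => // k f fs fw; set K := k.+1.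
pose W v := [set phi : {ffun G -> 'I_K} | phi v \in f v (restrict phi v)].
have cW v : #|W v| * K <= s * K ^ #|G|.
  pose upd (phi : {ffun G -> 'I_K}) c := [ffun x => if x == v then c else phi x].
  have rU phi c : restrict (upd phi c) v = restrict phi v.
    apply/ffunP=> -[u vu]; rewrite !ffunE /=; case: eqP => // uv.
    by move: vu; rewrite uv edge_irrefl.
  pose h (p : {ffun G -> 'I_K} * 'I_K) := (upd p.1 p.2, p.1 v).
  have h_inj : injective h.
    move=> [p c] [p' c'] [/ffunP eu ev]; congr (_, _).
      apply/ffunP=> x; have := eu x; rewrite !ffunE.
      by case: eqP => // ->.
    by have := eu v; rewrite !ffunE eqxx.
  have -> : #|W v| * K = #|h @: setX (W v) setT|.
    by rewrite (card_imset _ h_inj) cardsX cardsT card_ord.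
  pose Z := [set q : {ffun G -> 'I_K} * 'I_K | q.2 \in f v (restrict q.1 v)].
  apply: (@leq_trans #|Z|).
    apply/subset_leq_card/subsetP=> q /imsetP[[p c]].
    by rewrite !inE andbT /= => Wp ->; rewrite /= rU.
  rewrite -sum1_card (eq_bigl (fun q => true && (q.2 \in f v (restrict q.1 v)))).
    rewrite -(pair_big_dep xpredT (fun p c => c \in f v (restrict p v))
                (fun _ _ => 1)) /=.
    apply: (@leq_trans (\sum_(p : {ffun G -> 'I_K}) s)).
      by apply: leq_sum => p _; rewrite sum1_card; apply/forallP: (restrict p v).
    by rewrite sum_nat_const card_ffun card_ord mulnC.
  by move=> q; rewrite inE.
have cT : K ^ #|G| <= \sum_v #|W v|.
  have -> : K ^ #|G| = #|[set: {ffun G -> 'I_K}]|.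
    by rewrite cardsT card_ffun card_ord.
  apply: (@leq_trans #|\bigcup_v W v|).
    apply/subset_leq_card/subsetP=> phi _.
    by have /existsP[v fv] := fw phi; apply/bigcupP; exists v; rewrite ?inE.
  elim/big_rec2: _ => [|v m A _ IH]; first by rewrite cards0.
  by apply: leq_trans (leq_card_setU _ _) _; rewrite leq_add2l.
have K0 : 0 < K ^ #|G| by rewrite expn_gt0.
rewrite -(leq_pmul2l K0); apply: leq_trans (leq_mul cT (leqnn K)) _.
rewrite big_distrl /=; apply: (@leq_trans (\sum_(v : G) s * K ^ #|G|)).
  by apply: leq_sum => v _; apply: cW.
by rewrite sum_nat_const mulnC [K ^ _ * _]mulnC -mulnA [K ^ _ * _]mulnC mulnA.
Qed.

Lemma HG_geq k : winnable s G k -> k <= HG s G.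
Proof.
move=> wk; have kb : k < (s * #|G|).+1 by rewrite ltnS winnable_leq.
exact: (@leq_bigmax_cond _ _ (fun i => val i) (Ordinal kb)).
Qed.

Lemma winnable0 : 0 < #|G| -> winnable s G 0.
Proof.
case/card_gt0P=> x _.
apply/existsP; exists [ffun v => [ffun=> set0]]; apply/andP; split.
  by apply/forallP=> v; apply/forallP=> c; rewrite !ffunE cards0.
by apply/forallP=> phi; case: (phi x).
Qed.

Lemma HG_winnable : 0 < #|G| -> winnable s G (HG s G).
Proof.
move=> /winnable0 w0; rewrite /HG.
have [//|i wi ->] := @eq_bigmax_cond _
  [pred k : 'I_(s * #|G|).+1 | winnable s G k] (fun i => val i).
  by apply/card_gt0P; exists ord0.
exact: wi.
Qed.

End HGMax.

(* Main.v *)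
(* Call a colour of a vertex r forced if in every colouring giving r that colour
   somebody guesses correctly, and call a graph s-tame if, whatever the strategy
   with s guesses, each vertex has at most s forced colours.  Tameness is
   preserved by gluing along a vertex, as a tame graph hanging from u only turns
   the guesses of u into another set of at most s colours.  Hence it passes from
   blocks to graphs.  If G - a is t-tame for a suitable t polynomial in s, then G
   is s-tame; applied to K_2 this gives paths by gluing, and applied once more it
   gives petal graphs.  A tame graph is not winnable with more than s colours.
   The bound obtained is polynomial in s, far below the claimed one. *)
Require Import Defs.
From mathcomp Require Import all_boot.
From mathcomp Require Import zify.

Set Implicit Arguments.
Unset Strict Implicit.
Unset Printing Implicit Defensive.

(** * Strategies on a vertex set, and tame sets *)

Section Game.
Variables (T C : finType) (e : rel T).
Hypotheses (e_sym : symmetric e) (e_irr : irreflexive e).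
Implicit Types (A B : {set T}) (phi psi : {ffun T -> C}).
Implicit Types (F : T -> {ffun T -> C} -> {set C}).

(** Guesses read a colouring of all of [T], so passing to a subset changes no type; locality
    relative to [A] hides the vertices outside [A]. *)
Definition local_on A F := forall v, v \in A -> forall phi psi,
  (forall u, u \in A -> e v u -> phi u = psi u) -> F v phi = F v psi.

Definition bounded_on s A F := forall v phi, v \in A -> #|F v phi| <= s.

Definition fools A F phi := [forall v in A, phi v \notin F v phi].

Definition forced A F r :=
  [set x | ~~ [exists phi : {ffun T -> C}, (phi r == x) && fools A F phi]].

(* As seen from any of its vertices r, a tame graph is no better than r playing
   alone, with s guesses that do not depend on anything. *)
Definition tame s A := forall F, local_on A F -> bounded_on s A F ->
  forall r, r \in A -> #|forced A F r| <= s.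

Definition mix A phi psi := [ffun x => if x \in A then phi x else psi x].
Definition upd phi a c := [ffun x => if x == a then c else phi x].

Lemma forcedPn A F r x :
  reflect (exists2 phi : {ffun T -> C}, phi r = x & fools A F phi) (x \notin forced A F r).
Proof.
rewrite inE negbK; apply: (iffP existsP) => [[phi /andP[/eqP]]|[phi <- h]].
  by exists phi.
by exists phi; rewrite eqxx.
Qed.

Lemma forced_ext A F F' r : (forall v phi, v \in A -> F v phi = F' v phi) ->
  forced A F r = forced A F' r.
Proof.
move=> eF; apply/setP=> x; rewrite !inE; congr negb; apply: eq_existsb => phi.
congr andb; apply: eq_forallb => v.
by case vA: (v \in A) => //=; rewrite eF.
Qed.

Lemma sub_local A A1 F : A1 \subset A ->
  (forall v u, v \in A1 -> u \in A -> e v u -> u \in A1) ->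
  local_on A F -> local_on A1 F.
Proof.
move=> /subsetP sA cl lF v vA phi psi h; apply: lF; first exact: sA.
by move=> u uA vu; apply: h => //; apply: cl vu.
Qed.

Lemma sub_bounded s A A1 F : A1 \subset A -> bounded_on s A F -> bounded_on s A1 F.
Proof. by move=> /subsetP sA bF v phi vA; apply: bF; apply: sA. Qed.

(** At most s colours of a root are forced, so some colour of it extends to a fooling colouring. *)
Lemma tame_fools s A F : tame s A -> s < #|C| -> local_on A F ->
  bounded_on s A F -> exists phi, fools A F phi.
Proof.
move=> tA sC lF bF; have [A0|[r rA]] := set_0Vmem A.
  have /card_gt0P[c _] : 0 < #|C| by lia.
  by exists [ffun=> c]; apply/forall_inP=> v; rewrite A0 inE.
have /subsetPn[x _ /forcedPn[phi _ h]] : ~~ ([set: C] \subset forced A F r).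
  by apply/negP=> /subset_leq_card; have := tA F lF bF r rA; rewrite cardsT; lia.
by exists phi.
Qed.

(** A lone vertex sees nothing, so its guess is one fixed set. *)
Lemma tame1 s v : tame s [set v].
Proof.
move=> F lF bF r; rewrite inE => /eqP->.
have [C0|C0] := posnP #|C|.
  by apply: leq_trans (max_card _) _; rewrite C0.
have /card_gt0P[c _] := C0.
apply: leq_trans (bF v [ffun=> c] (set11 _)); apply/subset_leq_card/subsetP=> x.
apply: contraLR => xF; apply/forcedPn; exists [ffun=> x]; first by rewrite ffunE.
apply/forall_inP=> u; rewrite inE => /eqP->; rewrite ffunE.
rewrite (lF v (set11 _) _ [ffun=> c]) // => w; rewrite inE => /eqP->.
by rewrite e_irr.
Qed.

(** * Gluing tame sets *)

Lemma mixl A F phi psi v : local_on A F -> v \in A -> F v (mix A phi psi) = F v phi.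
Proof. by move=> lF vA; apply: lF => // u uA _; rewrite ffunE uA. Qed.

(** A colouring fooling one side is completed by one fooling the other, which exists since
    [s < #|C|]. *)
Lemma tameU_disjoint s A1 A2 : s < #|C| ->
  (forall x y, x \in A1 -> y \in A2 -> ~~ e x y) ->
  [disjoint A1 & A2] -> tame s A1 -> tame s A2 -> tame s (A1 :|: A2).
Proof.
move=> sC ne dj t1 t2.
(* By symmetry the root may be taken in the first set. *)
have half B1 B2 : (forall x y, x \in B1 -> y \in B2 -> ~~ e x y) ->
    [disjoint B1 & B2] -> tame s B1 -> tame s B2 ->
    forall F r, local_on (B1 :|: B2) F -> bounded_on s (B1 :|: B2) F ->
    r \in B1 -> #|forced (B1 :|: B2) F r| <= s.
  move=> {}ne {}dj {}t1 {}t2 F r lF bF rB.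
  have l1 : local_on B1 F.
    apply: sub_local lF; first exact: subsetUl.
    move=> v u vB; rewrite inE => /orP[//|uB].
    by rewrite (negPf (ne _ _ vB uB)).
  have l2 : local_on B2 F.
    apply: sub_local lF; first exact: subsetUr.
    move=> v u vB; rewrite inE => /orP[uB|//].
    by rewrite e_sym (negPf (ne _ _ uB vB)).
  have b1 : bounded_on s B1 F by apply: sub_bounded bF; apply: subsetUl.
  have b2 : bounded_on s B2 F by apply: sub_bounded bF; apply: subsetUr.
  apply: leq_trans (t1 F l1 b1 r rB); apply/subset_leq_card/subsetP=> x.
  apply: contraLR => /forcedPn[phi <- f1].
  have [psi f2] := tame_fools t2 sC l2 b2.
  apply/forcedPn; exists (mix B1 phi psi); first by rewrite ffunE rB.
  apply/forall_inP=> v; rewrite inE => /orP[vB|vB].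
    by rewrite mixl // ffunE vB (forall_inP f1).
  have nB w : w \in B2 -> (w \in B1) = false.
    by move=> wB; rewrite (disjointFl dj).
  rewrite (l2 v vB _ psi) => [|u uB _]; last by rewrite ffunE nB.
  by rewrite ffunE nB // (forall_inP f2).
move=> F lF bF r; rewrite inE => /orP[rA|rA]; first exact: half.
rewrite setUC in lF bF *; apply: half => //; last by rewrite disjoint_sym.
by move=> x y xA yA; rewrite e_sym ne.
Qed.

(* Contract A2 to the common vertex u, letting u guess the colours which are
   forced at u in A2: there are at most s of them, as A2 is tame. *)
Lemma tameU_glue s A1 A2 u : A1 :&: A2 = [set u] ->
  (forall x y, x \in A1 -> y \in A2 -> e x y -> (x == u) || (y == u)) ->
  tame s A1 -> tame s A2 -> tame s (A1 :|: A2).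
Proof.
move=> I12 cl t1 t2.
have half B1 B2 : B1 :&: B2 = [set u] ->
    (forall x y, x \in B1 -> y \in B2 -> e x y -> (x == u) || (y == u)) ->
    tame s B1 -> tame s B2 ->
    forall F r, local_on (B1 :|: B2) F -> bounded_on s (B1 :|: B2) F ->
    r \in B1 -> #|forced (B1 :|: B2) F r| <= s.
  move=> {}I12 {}cl {}t1 {}t2 F r lF bF rB.
  have /andP[u1 u2] : (u \in B1) && (u \in B2) by rewrite -in_setI I12 set11.
  have I v : v \in B1 -> v \in B2 -> v = u.
    by move=> v1 v2; apply/set1P; rewrite -I12 inE v1.
  have nbr1 v w : v \in B1 -> v != u -> w \in B1 :|: B2 -> e v w -> w \in B1.
    move=> v1 vu; rewrite inE => /orP[//|w2] vw.
    by have := cl _ _ v1 w2 vw; rewrite (negPf vu) => /eqP->.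
  have nbr2 v w : v \in B2 -> v != u -> w \in B1 :|: B2 -> e v w -> w \in B2.
    move=> v1 vu; rewrite inE => /orP[w2 vw|//].
    have := cl _ _ w2 v1; rewrite e_sym => /(_ vw).
    by rewrite (negPf vu) orbF => /eqP->.
  (* The game on [B2] with the colours outside [B2] frozen to those of [phi]. *)
  pose G phi v psi := F v (mix B2 psi phi).
  pose H v phi := if v == u then forced B2 (G phi) u else F v phi.
  have lG phi : local_on B2 (G phi).
    move=> v vB psi psi' h; apply: lF => [|w _ vw]; first by rewrite inE vB orbT.
    by rewrite !ffunE; case: ifP => // wB; apply: h.
  have bG phi : bounded_on s B2 (G phi).
    by move=> v psi vB; apply: bF; rewrite inE vB orbT.
  have lH : local_on B1 H.
    move=> v vB phi phi' h; rewrite /H; case: eqP => [vu|/eqP vu]; last first.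
      apply: lF => [|w wB vw]; first by rewrite inE vB.
      by apply: h => //; apply: nbr1 vw.
    (* In [B2] only [u] sees vertices outside [B2], so this forced set reads [phi] only at
       neighbours of [u]. *)
    apply: forced_ext => w psi wB; apply: lF => [|z zB wz].
      by rewrite inE wB orbT.
    rewrite !ffunE; case: ifP => // z2.
    have [wu|wu] := eqVneq w u; last by rewrite (nbr2 _ _ wB wu zB wz) in z2.
    by move: zB; rewrite inE z2 orbF => z1; apply: h; rewrite // vu -wu.
  have bH : bounded_on s B1 H.
    move=> v phi vB; rewrite /H; case: eqP => _; first exact: t2.
    by apply: bF; rewrite inE vB.
  apply: leq_trans (t1 H lH bH r rB); apply/subset_leq_card/subsetP=> x.
  apply: contraLR => /forcedPn[phi <- f1].
  (* The colour [phi u] is not forced in [B2], so some [psi] fools [B2] and agrees with [phi] at the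
     shared vertex. *)
  have := forall_inP f1 u u1; rewrite /H eqxx => /forcedPn[psi psiu f2].
  have theta1 v : v \in B1 -> mix B2 psi phi v = phi v.
    by rewrite ffunE; case: ifP => // v2 v1; rewrite (I v).
  apply/forcedPn; exists (mix B2 psi phi); first exact: theta1.
  apply/forall_inP=> v vB; have [v2|v2] := boolP (v \in B2).
    by rewrite {1}ffunE v2; apply: (forall_inP f2).
  have v1 : v \in B1 by move: vB; rewrite inE (negPf v2) orbF.
  have vu : v != u by apply: contraNneq v2 => ->.
  rewrite theta1 // (lF v vB _ phi) => [|w wB vw].
    by have := forall_inP f1 v v1; rewrite /H (negPf vu).
  by apply: theta1; apply: nbr1 vw.
move=> F lF bF r; rewrite inE => /orP[rA|rA]; first exact: half.
rewrite setUC in lF bF *; apply: half => //; first by rewrite setIC.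
by move=> x y xA yA; rewrite e_sym orbC; apply: cl.
Qed.

(** * Counting, and deletion of one vertex *)

(** Each x covers at most s pairs through [g], each y at most s through [h]. *)
Lemma card_cross s (D : finType) (X : {set C}) (Y : {set D})
    (g : C -> {set D}) (h : D -> {set C}) :
  (forall x, #|g x| <= s) -> (forall y, #|h y| <= s) ->
  (forall x y, x \in X -> y \in Y -> (y \in g x) || (x \in h y)) ->
  #|X| * #|Y| <= (#|X| + #|Y|) * s.
Proof.
move=> gs hs cr; rewrite -cardsX.
pose U1 := [set p : C * D | (p.1 \in X) && (p.2 \in g p.1)].
pose U2 := [set p : C * D | (p.2 \in Y) && (p.1 \in h p.2)].
apply: (@leq_trans #|U1 :|: U2|).
  apply/subset_leq_card/subsetP=> -[x y]; rewrite !inE /= => /andP[xX yY].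
  by rewrite xX yY cr.
apply: leq_trans (leq_card_setU _ _) _; rewrite mulnDl; apply: leq_add.
  rewrite -sum1_card (eq_bigl (fun p => (p.1 \in X) && (p.2 \in g p.1))) => [|p].
    rewrite -(pair_big_dep (mem X) (fun x y => y \in g x) (fun _ _ => 1)) /=.
    by rewrite -sum_nat_const; apply: leq_sum => x _; rewrite sum1_card.
  by rewrite inE.
rewrite -sum1_card (eq_bigl (fun p => (p.2 \in Y) && (p.1 \in h p.2))) => [|p].
  rewrite (reindex (fun q : D * C => (q.2, q.1))) /=; last first.
    by exists (fun p => (p.2, p.1)) => -[].
  rewrite -(pair_big_dep (mem Y) (fun x y => y \in h x) (fun _ _ => 1)) /=.
  by rewrite -sum_nat_const; apply: leq_sum => x _; rewrite sum1_card.
by rewrite inE.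
Qed.

Lemma sub_card (A : {set C}) n : n <= #|A| -> exists2 B : {set C}, B \subset A & #|B| = n.
Proof.
move=> nA; exists [set x in take n (enum A)].
  by apply/subsetP=> x; rewrite inE => /mem_take; rewrite mem_enum.
rewrite cardsE; have /card_uniqP-> : uniq (take n (enum A)).
  exact: take_uniq (enum_uniq _).
by rewrite size_takel // -cardE.
Qed.


Lemma card_bigcup (I : finType) (X : {set I}) (g : I -> {set C}) s :
  (forall x, #|g x| <= s) -> #|\bigcup_(x in X) g x| <= #|X| * s.
Proof.
move=> gs; rewrite -sum_nat_const.
elim/big_rec2: _ => [|x n B _ IH]; first by rewrite cards0.
by apply: leq_trans (leq_card_setU _ _) _; apply: leq_add.
Qed.

(** Bounds a union of s-colour guesses over (s + 1)(s^2 + s + 1) pairs of colours. *)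
Definition cost s := s.+1 * ((s ^ 2 + s + 1) * s).

(* Confine the root r to s + 1 forced colours X and the vertex a to s^2 + s + 1
   colours Y, and fool the other vertices against all pairs in X * Y at once.
   Only a and r remain, and by counting they cannot cover X * Y. *)
Lemma tame_apex s A a : a \in A -> cost s < #|C| ->
  tame (cost s) (A :\ a) -> tame s A.
Proof.
move=> aA sC tA F lF bF r rA; rewrite leqNgt; apply/negP=> /sub_card[X sX cX].
have pC : s ^ 2 + s + 1 <= #|[set: C]|.
  by rewrite cardsT; move: sC; rewrite /cost; case: (s) => [|n]; nia.
have [Y _ cY] := sub_card pC.
have [c0 c0Y] : exists c, c \in Y by apply/set0Pn; rewrite -card_gt0 cY addn1.
pose w phi x y := upd (upd phi a y) r x.
(* [w] overwrites the colour of [r], so [r] may pass; the others guess all that they would guess for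
   some pair. *)
pose H v phi := if v == r then set0 else
  \bigcup_(x in X) \bigcup_(y in Y) F v (w phi x y).
have lH : local_on (A :\ a) H.
  move=> v; rewrite in_setD1 => /andP[va vA] phi psi h.
  rewrite /H; case: eqP => // _; apply: eq_bigr => x _; apply: eq_bigr => y _.
  apply: lF => // u uA vu; rewrite !ffunE; case: eqP => // _.
  by case: eqP => // /eqP ua; apply: h; rewrite // in_setD1 ua.
have bH : bounded_on (cost s) (A :\ a) H.
  move=> v phi; rewrite in_setD1 => /andP[va vA]; rewrite /H.
  case: eqP => _; first by rewrite cards0.
  rewrite /cost -cX -cY; apply: card_bigcup => x; apply: card_bigcup => y.
  exact: bF.
have [phi /forall_inP fphi] := tame_fools tA sC lH bH.
have wr x y : w phi x y r = x by rewrite ffunE eqxx.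
have wa x y : r != a -> w phi x y a = y.
  by move=> ra; rewrite !ffunE eqxx eq_sym (negPf ra).
have guess x y : x \in X -> y \in Y ->
    (w phi x y a \in F a (w phi x y)) || (x \in F r (w phi x y)).
  move=> xX yY; have := subsetP sX x xX; rewrite inE => /existsPn/(_ (w phi x y)).
  rewrite wr eqxx /= negb_forall_in => /exists_inP[v vA]; rewrite negbK => vF.
  have [va|va] := eqVneq v a; first by rewrite -va vF.
  have [vr|vr] := eqVneq v r; first by rewrite vr wr in vF; rewrite vF orbT.
  have := fphi v; rewrite in_setD1 va => /(_ vA); rewrite /H (negPf vr).
  case/negP; apply/bigcupP; exists x => //; apply/bigcupP; exists y => //.
  by move: vF; rewrite {1}/w !ffunE (negPf vr) (negPf va).
(* If r = a, only x survives in [w], and a single guess of [r] would contain all of [X]. *)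
have [ra|ra] := eqVneq r a.
  have : #|X| <= s.
    apply: leq_trans (bF r phi rA); apply/subset_leq_card/subsetP=> x xX.
    have := guess x c0 xX c0Y; rewrite -ra wr orbb (lF r rA _ phi) // => u uA ru.
    by rewrite !ffunE -ra; case: eqP => // ur; rewrite ur e_irr in ru.
  by rewrite cX ltnn.
(* No vertex sees its own colour: the guess of [a] depends on x alone, that of [r] on y alone, and
   [c0] is a filler. *)
have cov x y : x \in X -> y \in Y ->
    (y \in F a (w phi x c0)) || (x \in F r (w phi c0 y)).
  move=> xX yY.
  have := guess x y xX yY; rewrite wa //.
  rewrite (lF a aA _ (w phi x c0)) => [|u uA au].
    rewrite (lF r rA (w phi x y) (w phi c0 y)) // => u uA ru.
    by rewrite !ffunE; case: eqP => // ur; rewrite ur e_irr in ru.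
  by rewrite !ffunE; case: eqP => // _; case: eqP => // ua; rewrite ua e_irr in au.
(* (s + 1)(s^2 + s + 1) exceeds (s^2 + 2s + 2)s by exactly 1. *)
have := card_cross (fun x => bF _ (w phi x c0) aA) (fun y => bF _ (w phi c0 y) rA) cov.
by rewrite cX cY; nia.
Qed.

(** * Paths and petal graphs *)

(** Deleting one end leaves a single vertex, tame for any number of guesses. *)
Lemma tame_pair s u v : cost s < #|C| -> tame s [set u; v].
Proof.
move=> sC; have [->|uv] := eqVneq u v; first by rewrite setUid; apply: tame1.
apply: (@tame_apex _ _ u) => //; first by rewrite !inE eqxx.
suff -> : [set u; v] :\ u = [set v] by apply: tame1.
by apply/setP=> x; rewrite !inE; case: eqVneq => //= ->; rewrite (negPf uv).
Qed.

(** The labels place [A] inside a path. The vertex of largest label has at most one neighbour in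
    [A]: it is glued on as a pair or added as an isolated vertex. *)
Lemma tame_path s (l : T -> nat) A : cost s < #|C| -> {in A &, injective l} ->
  {in A &, forall x y, e x y -> (l x == (l y).+1) || (l y == (l x).+1)} ->
  tame s A.
Proof.
move=> sC; have [n] := ubnP #|A|; elim: n A => // n IH A.
rewrite ltnS => An linj le.
have [->|[v0 v0A]] := set_0Vmem A; first by move=> F _ _ r; rewrite inE.
have [v vA vmax] := arg_maxnP l v0A; rewrite -/(v \in A) in vA.
have sub x : x \in A :\ v -> x \in A by case/setD1P.
have tA : tame s (A :\ v).
  apply: IH; first by move: An; rewrite (cardsD1 v A) vA.
    by move=> x y /sub xA /sub yA; apply: linj.
  by move=> x y /sub xA /sub yA; apply: le.
have nbr x : x \in A :\ v -> e x v -> l v = (l x).+1.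
  move=> /sub xA xv; have := le x v xA vA xv.
  by case/orP => /eqP // h; have := vmax x xA; rewrite /= h; lia.
have [/exists_inP[u uA uv]|/exists_inPn nu] := boolP [exists u in A :\ v, e u v].
  have -> : A = (A :\ v) :|: [set u; v].
    apply/setP=> x; rewrite !inE.
    have [->|] := eqVneq x v; first by rewrite vA orbT.
    by have [->|] := eqVneq x u; rewrite ?orbF //= (sub u uA).
  apply: (@tameU_glue _ _ _ u) => //; last exact: tame_pair.
    apply/setP=> x; rewrite !inE.
    have [->|xv] := eqVneq x v; last first.
      by have [->|] := eqVneq x u; rewrite ?andbF //= (sub u uA).
    by apply/esym/negP=> /eqP vu; move: uA; rewrite vu !inE eqxx.
  move=> x y xA; rewrite !inE => /orP[-> _|/eqP-> xv]; first by rewrite orbT.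
  have := nbr _ xA xv; rewrite (nbr _ uA uv) => -[] lxu.
  by rewrite (linj x u) ?eqxx //; apply: sub.
have -> : A = (A :\ v) :|: [set v].
  by apply/setP=> x; rewrite !inE; case: eqVneq => [->|]; rewrite ?orbF.
apply: tameU_disjoint => //; last exact: tame1.
- by move: sC; rewrite /cost; nia.
- by move=> x y xA; rewrite inE => /eqP->; apply: nu.
- by rewrite disjoint_sym disjoints1 !inE eqxx.
Qed.

End Game.

(** One [cost] pays for deleting the apex, the other for the edges of the remaining path. *)
Lemma tame_subpetal (C : finType) (G : sgraph) (A : {set G}) s n :
  cost (cost s) < #|C| -> subgraph_of (induced A) (petal n) ->
  tame C (@edge G) s A.
Proof.
move=> sC [f finj fe].
(* Position on the path; the default 0 is never met on the sets [B] below, which lie in [A] and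
   avoid the apex. *)
pose l (x : G) := if insub x : option (induced A) is Some z then
  (if f z is Some i then val i else 0) else 0.
have path t (B : {set G}) : B \subset A -> cost t < #|C| ->
    (forall z : induced A, val z \in B -> f z != None) ->
    tame C (@edge G) t B.
  move=> /subsetP BA tC fB.
  have lift x : x \in B -> exists z : induced A,
      [/\ val z = x & exists2 i, f z = Some i & l x = i].
    move=> xB; have xA := BA x xB; exists (Sub x xA); split=> //.
    have := fB (Sub x xA) xB; rewrite /l insubT.
    by case: (f _) => // i _; exists i.
  apply: (@tame_path _ _ _ (@edge_sym G) (@edge_irrefl G) _ l) => //.
    move=> x y /lift[z [<- [i fz ->]]] /lift[z' [<- [j fz' ->]]] ij.
    by congr val; apply: finj; rewrite fz fz'; congr Some; apply: val_inj.
  move=> x y /lift[z [<- [i fz ->]]] /lift[z' [<- [j fz' ->]]] zz'.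
  have := fe z z' zz'; rewrite fz fz' /= => /orP[/eqP->|/eqP->];
    by rewrite eqxx ?orbT.
have [a /eqP fa|nf] := pickP (fun z => f z == None); last first.
  apply: path => // [|z _]; last by rewrite nf.
  by apply: leq_ltn_trans sC; rewrite {2}/cost; nia.
apply: (@tame_apex _ _ _ (@edge_irrefl G) _ _ (val a)) => //.
- exact: valP.
- by apply: leq_ltn_trans sC; rewrite {2}/cost; nia.
- apply: path => // [|z]; first exact: subsetDl.
  rewrite !inE => /andP[za _]; apply: contraNneq za => fz.
  by apply/eqP; congr val; apply: finj; rewrite fz fa.
Qed.

(** * Decomposition into blocks *)

Definition avoid (H : sgraph) (v : H) : rel H :=
  [rel a b | [&& a != v, b != v & edge a b]].

Definition connected_no_cutb (H : sgraph) :=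
  [&& 0 < #|H|, [forall x, forall y, connect (@edge H) x y] &
    ~~ [exists v, exists x, exists y, [&& x != v, y != v,
       connect (@edge H) x y & ~~ connect (avoid v) x y]]].

Lemma connected_no_cutP H : reflect (connected_no_cut H) (connected_no_cutb H).
Proof.
apply: (iffP and3P) => [[H0 /forallP c /existsPn n]|[[H0 c] n]].
  split=> [|v [x [y [xv yv xy nxy]]]].
    by split=> // x y; apply: (forallP (c x)).
  have /existsPn/(_ x)/existsPn/(_ y) := n v.
  by rewrite xv yv xy nxy.
split=> //; first by apply/forallP=> x; apply/forallP=> y.
apply/existsP=> -[v /existsP[x /existsP[y /and4P[xv yv xy nxy]]]].
by apply: (n v); exists x, y.
Qed.

(** [A] extends to a maximal such set, which is a block, and embeds with it. *)
Lemma petunia_subpetal (G : sgraph) (A : {set G}) : petunia G ->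
  connected_no_cut (induced A) -> exists n, subgraph_of (induced A) (petal n).
Proof.
move=> hG /connected_no_cutP cA.
have [B /maxsetP[cB maxB] AB] :=
  @maxset_exists G (fun B => connected_no_cutb (induced B)) A cA.
have [|n [f finj fe]] := hG B.
  by split=> [|D BD /connected_no_cutP cD]; [apply/connected_no_cutP | apply: maxB].
pose h (x : induced A) : induced B := Sub (val x) (subsetP AB _ (valP x)).
exists n, (f \o h) => [|x y xy]; last by apply: fe.
by move=> x y /finj /(congr1 val) /= /val_inj.
Qed.

Lemma tame_of_proper (C : finType) (G : sgraph) (A : {set G}) s : s < #|C| ->
  ~~ connected_no_cutb (induced A) ->
  (forall B : {set G}, B \proper A -> tame C (@edge G) s B) ->
  tame C (@edge G) s A.
Proof.
move=> sC nA IH.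
(* The empty graph does not count as connected, but it has no root and is tame. *)
have [->|[v0 v0A]] := set_0Vmem A; first by move=> F _ _ r; rewrite inE.
have split (D : {set G}) : D \subset A -> A = D :|: (A :\: D).
  move=> /subsetP DA; apply/setP=> x; rewrite !inE.
  by case: (boolP (x \in D)) => [/DA->|].
have [c|] := boolP [forall x, forall y, connect (@edge (induced A)) x y]; last first.
  rewrite negb_forall => /existsP[x]; rewrite negb_forall => /existsP[y nxy].
  pose D := [set val z | z in connect (@edge (induced A)) x].
  have mD z : (val z \in D) = connect (@edge (induced A)) x z.
    by rewrite mem_imset //; apply: val_inj.
  have DA : D \subset A by apply/subsetP=> _ /imsetP[z _ ->]; apply: valP.
  rewrite (split _ DA); apply: tameU_disjoint => //.
  - exact: edge_sym.
  - move=> _ q /imsetP[z xz ->]; rewrite !inE => /andP[qD qA].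
    apply: contra qD => zq; have -> : q = val (Sub q qA : induced A) by [].
    by rewrite mD; apply: connect_trans xz (connect1 _).
  - by rewrite -setI_eq0 setIDA setIC setDIl setDv setI0.
  - apply: IH; rewrite properE DA; apply/subsetPn; exists (val y); first exact: valP.
    by rewrite mD.
  - apply: IH; rewrite properE subsetDl; apply/subsetPn; exists (val x).
      exact: valP.
    by rewrite inE mD connect0.
have cut : [exists v, exists x, exists y, [&& x != v, y != v,
    connect (@edge (induced A)) x y & ~~ connect (avoid v) x y]].
  move: nA; rewrite /connected_no_cutb c /= negb_and negbK => /orP[|//].
  by case/negP; apply/card_gt0P; exists (Sub v0 v0A).
have [v /existsP[x /existsP[y /and4P[xv yv _ nxy]]]] := existsP cut.
(* The component of x in A - v; adding v to it misses y, and its complement in [A] misses x, so both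
   glued sets are proper. *)
pose D := [set val z | z in [pred z | (z != v) && connect (avoid v) x z]].
have mD z : (val z \in D) = (z != v) && connect (avoid v) x z.
  by rewrite mem_imset //; apply: val_inj.
have DA : D \subset A by apply/subsetP=> _ /imsetP[z _ ->]; apply: valP.
have -> : A = (val v |: D) :|: (A :\: D).
  by rewrite -setUA -(split _ DA); apply/esym/setUidPr; rewrite sub1set; apply: valP.
apply: (@tameU_glue _ _ _ _ _ _ _ (val v)).
- exact: edge_sym.
- apply/setP=> q; rewrite !inE; case: eqVneq => [->|_] /=; last first.
    by case: (q \in D).
  by rewrite mD eqxx /=; apply: valP.
- move=> p q; rewrite !inE => /orP[-> //|/imsetP[z /andP[zv xz] ->]] /andP[qD qA].
  have -> : q = val (Sub q qA : induced A) by [].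
  move=> zq; apply/orP; right; apply: contraR qD => qv.
  have -> : q = val (Sub q qA : induced A) by [].
  have qv' : (Sub q qA : induced A) != v by apply: contraNneq qv => ->.
  rewrite mD qv' /=; apply: connect_trans xz (connect1 _).
  by apply/and3P.
- apply: IH; rewrite properE subUset sub1set DA (valP v) /=.
  apply/subsetPn; exists (val y); first exact: valP.
  by rewrite !inE mD (negPf nxy) andbF orbF (inj_eq val_inj).
- apply: IH; rewrite properE subsetDl; apply/subsetPn; exists (val x).
    exact: valP.
  by rewrite inE mD xv connect0.
Qed.

(** Induction on all vertex subsets, which is why [petunia_subpetal] is not restricted to blocks. *)
Lemma petunia_tame (C : finType) (G : sgraph) (A : {set G}) s : petunia G ->
  cost (cost s) < #|C| -> tame C (@edge G) s A.
Proof.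
move=> hG sC; have [n] := ubnP #|A|; elim: n A => // n IH A; rewrite ltnS => An.
have [/connected_no_cutP /(petunia_subpetal hG)[m]|] :=
  boolP (connected_no_cutb (induced A)); first exact: tame_subpetal.
move/tame_of_proper; apply; first by apply: leq_ltn_trans sC; rewrite /cost; nia.
by move=> B /proper_card BA; apply: IH; apply: leq_trans BA An.
Qed.

(** * From tameness to the numerical bound *)

Lemma tame_winnable s (G : sgraph) k : s < k ->
  tame 'I_k (@edge G) s [set: G] -> ~~ winnable s G k.
Proof.
move=> sk tG; apply/negP=> /existsP[f /andP[/forallP fs /forallP fw]].
pose F v (phi : {ffun G -> 'I_k}) := f v (restrict phi v).
have lF : local_on (@edge G) setT F.
  move=> v _ phi psi h; congr (f v _); apply/ffunP=> -[u vu].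
  by rewrite !ffunE; apply: h.
have bF : bounded_on s setT F by move=> v phi _; apply: (forallP (fs v)).
have [|phi /forall_inP fphi] := tame_fools tG _ lF bF; first by rewrite card_ord.
by have /existsP[v] := fw phi; apply/negP/fphi.
Qed.

Theorem theorem3p3 (s : nat) (hs : 1 <= s) (G : sgraph) (hG : petunia G) :
  HG s G <= (3 * s ^ 2 + 3 * s + 3) ^ (3 * (s ^ 2 + s + 1) ^ 2).
Proof.
pose p := s ^ 2 + s + 1.
have -> : 3 * s ^ 2 + 3 * s + 3 = 3 * p by rewrite /p; lia.
have p3 : 3 <= p by rewrite /p; nia.
have cb : cost (cost s) <= (3 * p) ^ (3 * p ^ 2).
  (* Since s(s + 1) = p - 1, [cost s] equals (p - 1)p. *)
  have c1 : cost s < p ^ 2 by rewrite /cost /p; nia.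
  have c2 : cost s * (cost s).+1 < p ^ 4 by nia.
  apply: (@leq_trans (p ^ 8)).
    by rewrite /cost -/(cost s); nia.
  apply: (@leq_trans ((3 * p) ^ 8)); first by rewrite leq_exp2r //; lia.
  (* As p is at least 3, the exponent 3p^2 is at least 27. *)
  by rewrite leq_exp2l; nia.
apply/bigmax_leqP=> k; apply: contraTT; rewrite -ltnNge => kb.
have ck := leq_ltn_trans cb kb.
apply: tame_winnable; last by apply: petunia_tame; rewrite ?card_ord.
by apply: leq_ltn_trans ck; rewrite /cost; nia.
Qed.
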